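(* For any connected bimonoid $\mathbf{h}$ in species over a field $\Bbbk$, $$\Psi(\mathtt{D})=\mathrm{S}*\mathrm{N},$$ the convolution product of the antipode $\mathrm{S}$ of $\mathbf{h}$ and the number operator $\mathrm{N}$.
   Context: Species and bimonoids. A species is a functor $\mathbf{p}$ from the category of finite sets and bijections to $\Bbbk$-vector spaces; morphisms are natural transformations. $I=S\sqcup T$ means that $(S,T)$ is an ordered pair of disjoint, possibly empty, subsets with union $I$. The Cauchy product is $(\mathbf{p}\cdot\mathbf{q})[I]=\bigoplus_{I=S\sqcup T}\mathbf{p}[S]\otimes\mathbf{q}[T]$; with the symmetry $x\otimes y\mapsto y\otimes x$ and unit the species that is $\Bbbk$ on $\emptyset$ and $0$ elsewhere, species form a symmetric monoidal category. Monoids, comonoids and bimonoids are taken in this category, with structure maps $\mu_{S,T},\iota_\emptyset$ (product $\mathbf{a}[S]\otimes\mathbf{a}[T]\to\mathbf{a}[I]$, unit) and $\Delta_{S,T},\epsilon_\emptyset$ (coproduct $\mathbf{c}[I]\to\mathbf{c}[S]\otimes\mathbf{c}[T]$, counit); in a bimonoid, product and unit are morphisms of comonoids. A bimonoid is connected if $\dim\mathbf{h}[\emptyset]=1$. For species endomorphisms of $\mathbf{h}$, the convolution product is $(f*g)_I=\sum_{I=S\sqcup T}\mu_{S,T}(f_S\otimes g_T)\Delta_{S,T}$, with unit $u$ given by $u_\emptyset=\iota_\emptyset\epsilon_\emptyset$, $u_I=0$ for $I\neq\emptyset$. The antipode $\mathrm{S}$ of $\mathbf{h}$ is the convolution inverse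 of $\mathrm{id}$; it exists for every connected bimonoid. The number operator is $\mathrm{N}_I(x)=|I|\,x$ for $x\in\mathbf{h}[I]$. A composition $F=(I_1,\dots,I_k)\vDash I$ is a sequence of pairwise disjoint nonempty subsets with union $I$; $\ell(F)=k$ and $\omega(F)=I_k$ is its last block. $\mu_F:\mathbf{h}[I_1]\otimes\cdots\otimes\mathbf{h}[I_k]\to\mathbf{h}[I]$ and $\Delta_F$ in the other direction are the iterated product and coproduct (identities for $k=1$). $\mathbf{\Sigma}[I]$ is the vector space with basis $\mathtt{H}_F$, $F\vDash I$. $\mathtt{D}$ (the Dynkin quasi-idempotent) is the series with $\mathtt{D}_\emptyset=0$ and $\mathtt{D}_I=\sum_{F\vDash I}(-1)^{\ell(F)-1}|\omega(F)|\,\mathtt{H}_F\in\mathbf{\Sigma}[I]$ for $I\ne\emptyset$. For $z=\sum_F a_F\mathtt{H}_F\in\mathbf{\Sigma}[I]$, $\Psi_I(z)=\sum_F a_F\,\mu_F\Delta_F\in\mathrm{End}_\Bbbk(\mathbf{h}[I])$; for a series $s=(s_I)$, $\Psi(s):\mathbf{h}\to\mathbf{h}$ has components $\Psi_I(s_I)$. *)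

(* Defs.v *)
From HB Require Import structures.
From mathcomp Require Import all_boot all_order all_algebra.
From mathcomp Require Import boolp.

Set Implicit Arguments.
Unset Strict Implicit.
Unset Printing Implicit Defensive.

Import GRing.Theory.
Local Open Scope ring_scope.
Local Open Scope quotient_scope.

(* [tensor V W] is the set of formal finite sums of pairs [(v, w)], identified
   when no bilinear map tells them apart.  Its universal property is given by
   [tens_is_bilinear], [tliftE] (existence) and [tens_ext] (uniqueness). *)

Section Tensor.
Variables (k : fieldType) (V W : lmodType k).

Definition tsum_eval (X : lmodType k) (b : V -> W -> X) (s : seq (V * W)) : X :=
  \sum_(p <- s) b p.1 p.2.

Definition tsum_eq (s t : seq (V * W)) : bool :=
  `[< forall (X : lmodType k) (b : {bilinear V -> W -> X}),
        tsum_eval b s = tsum_eval b t >].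

Lemma tsum_eq_refl : reflexive tsum_eq.
Proof. by move=> s; apply/asboolP. Qed.

Lemma tsum_eq_sym : symmetric tsum_eq.
Proof. by move=> s t; apply/asboolP/asboolP => st X b; rewrite st. Qed.

Lemma tsum_eq_trans : transitive tsum_eq.
Proof.
by move=> t s u /asboolP st /asboolP tu; apply/asboolP => X b; rewrite st tu.
Qed.

Canonical tsum_equiv :=
  EquivRel tsum_eq tsum_eq_refl tsum_eq_sym tsum_eq_trans.

Definition tensor_carrier := {eq_quot tsum_equiv}.
HB.instance Definition _ := Choice.on tensor_carrier.
HB.instance Definition _ := EqQuotient.on tensor_carrier.

Definition tpi (s : seq (V * W)) : tensor_carrier := \pi_tensor_carrier s.

Lemma tpiP (s t : seq (V * W)) :
  (forall (X : lmodType k) (b : {bilinear V -> W -> X}),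
     tsum_eval b s = tsum_eval b t) <-> tpi s = tpi t.
Proof.
split=> [st|/eqmodP/asboolP//].
by apply/eqmodP/asboolP.
Qed.

Lemma tsum_evalK (X : lmodType k) (b : {bilinear V -> W -> X}) s :
  tsum_eval b (repr (tpi s)) = tsum_eval b s.
Proof. by apply: (tpiP _ _).2; rewrite /tpi reprK. Qed.

Lemma tpi_repr (t : tensor_carrier) : tpi (repr t) = t.
Proof. by rewrite /tpi reprK. Qed.

Definition tensor_scale (a : k) (x : tensor_carrier) : tensor_carrier :=
  tpi [seq (a *: p.1, p.2) | p <- repr x].
Definition tensor_add (x y : tensor_carrier) : tensor_carrier :=
  tpi (repr x ++ repr y).
Definition tensor_opp (x : tensor_carrier) : tensor_carrier :=
  tensor_scale (- 1) x.

Lemma tsum_eval_cat (X : lmodType k) (b : V -> W -> X) s t :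
  tsum_eval b (s ++ t) = tsum_eval b s + tsum_eval b t.
Proof. exact: big_cat. Qed.

Lemma tsum_eval_scale (X : lmodType k) (b : {bilinear V -> W -> X}) a s :
  tsum_eval b [seq (a *: p.1, p.2) | p <- s] = a *: tsum_eval b s.
Proof.
rewrite /tsum_eval big_map scaler_sumr; apply: eq_bigr => p _ /=.
by rewrite linearZl_LR.
Qed.

Let tevE := (tsum_evalK, tsum_eval_cat, tsum_eval_scale).

Lemma tensor_addA : associative tensor_add.
Proof. by move=> x y z; apply/tpiP => X b; rewrite !tevE addrA. Qed.

Lemma tensor_addC : commutative tensor_add.
Proof. by move=> x y; apply/tpiP => X b; rewrite !tevE addrC. Qed.

Lemma tensor_add0 : left_id (tpi [::]) tensor_add.
Proof.
move=> x; rewrite -[RHS]tpi_repr; apply/tpiP => X b.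
by rewrite !tevE /tsum_eval big_nil add0r.
Qed.

Lemma tensor_addN : left_inverse (tpi [::]) tensor_opp tensor_add.
Proof.
move=> x; apply/tpiP => X b.
by rewrite !tevE scaleN1r addNr /tsum_eval big_nil.
Qed.

HB.instance Definition _ := GRing.isZmodule.Build tensor_carrier
  tensor_addA tensor_addC tensor_add0 tensor_addN.

Lemma tensor_scaleA a b x :
  tensor_scale a (tensor_scale b x) = tensor_scale (a * b) x.
Proof. by apply/tpiP => X f; rewrite !tevE scalerA. Qed.

Lemma tensor_scale1 : left_id 1 tensor_scale.
Proof.
by move=> x; rewrite -[RHS]tpi_repr; apply/tpiP => X f; rewrite !tevE scale1r.
Qed.

Lemma tensor_scaleDr : right_distributive tensor_scale +%R.
Proof. by move=> a x y; apply/tpiP => X f; rewrite !tevE scalerDr. Qed.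

Lemma tensor_scaleDl x : {morph tensor_scale^~ x : a b / a + b}.
Proof. by move=> a b; apply/tpiP => X f; rewrite !tevE scalerDl. Qed.

HB.instance Definition _ := GRing.Zmodule_isLmodule.Build k tensor_carrier
  tensor_scaleA tensor_scale1 tensor_scaleDr tensor_scaleDl.

Definition tensor : lmodType k := GRing.Lmodule.clone k tensor_carrier _.

Definition tens (v : V) (w : W) : tensor := tpi [:: (v, w)].

Lemma tens_is_bilinear : bilinear_for *:%R *:%R tens.
Proof.
split=> [w a u v|v a u w]; apply/tpiP => X b; rewrite !tevE;
  by rewrite /tsum_eval !big_seq1 /= (linearPl, linearPr).
Qed.

HB.instance Definition _ :=
  bilinear_isBilinear.Build k V W tensor _ _ tens tens_is_bilinear.
HB.instance Definition _ (v : V) :=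
  GRing.isLinear.Build k W tensor _ (tens v) (tens_is_bilinear.2 v).

Lemma tpiE s : tpi s = \sum_(p <- s) tens p.1 p.2.
Proof.
elim: s => [|[v w] s IHs]; first by rewrite big_nil.
rewrite big_cons -IHs; apply/tpiP => X b.
by rewrite !tevE /tsum_eval big_cons big_seq1.
Qed.

Lemma tens_span (t : tensor) :
  exists s : seq (V * W), t = \sum_(p <- s) tens p.1 p.2.
Proof. by exists (repr t); rewrite -tpiE tpi_repr. Qed.

Lemma tensor_ind (P : tensor -> Prop) :
    P 0 -> (forall x y, P x -> P y -> P (x + y)) ->
    (forall v w, P (tens v w)) ->
  forall t, P t.
Proof. by move=> P0 PD Pt t; have [s ->] := tens_span t; apply: big_ind. Qed.

Lemma tens_ext (X : lmodType k) (f g : {linear tensor -> X}) :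
  (forall v w, f (tens v w) = g (tens v w)) -> f =1 g.
Proof.
move=> fg t; have [s ->] := tens_span t.
by rewrite !linear_sum; apply: eq_bigr => p _.
Qed.

End Tensor.

Arguments tensor : simpl never.
Arguments tens {k V W} v w : simpl never.

HB.lock Definition tlift_fun (k : fieldType) (V W X : lmodType k)
    (b : V -> W -> X) (t : tensor V W) : X := tsum_eval b (repr t).

Section Lift.
Variables (k : fieldType) (V W X : lmodType k) (b : {bilinear V -> W -> X}).

Lemma tlift_is_linear : linear (tlift_fun b).
Proof.
move=> a x y; rewrite !tlift_fun.unlock.
by rewrite !(tsum_evalK, tsum_eval_cat, tsum_eval_scale).
Qed.

HB.instance Definition _ :=
  GRing.isLinear.Build k (tensor V W) X _ (tlift_fun b) tlift_is_linear.

Definition tlift : {linear tensor V W -> X} :=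
  GRing.Linear.clone k (tensor V W) X _ (tlift_fun b) _.

Lemma tliftE v w : tlift (tens v w) = b v w.
Proof. by rewrite /= tlift_fun.unlock tsum_evalK /tsum_eval big_seq1. Qed.

End Lift.

Arguments tlift : simpl never.

(* [bilinear_for] with all its scalings at the same canonical [lmodType k]. *)
Lemma bilinearI (k : fieldType) (V W X : lmodType k) (f : V -> W -> X) :
    (forall w a u v, f (a *: u + v) w = a *: f u w + f v w) ->
    (forall v a u w, f v (a *: u + w) = a *: f v u + f v w) ->
  bilinear_for *:%R *:%R f.
Proof. by split. Qed.

Section TensorMaps.
Variable k : fieldType.

Section Map.
Variables (V W V' W' : lmodType k).
Variables (f : {linear V -> V'}) (g : {linear W -> W'}).

Definition tmap_bil (v : V) (w : W) : tensor V' W' := tens (f v) (g w).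

Lemma tmap_bilP : bilinear_for *:%R *:%R tmap_bil.
Proof.
apply: bilinearI => [w a u v|v a u w]; rewrite /tmap_bil linearP;
  by rewrite (linearPl, linearPr).
Qed.

HB.instance Definition _ :=
  bilinear_isBilinear.Build k V W _ _ _ tmap_bil tmap_bilP.

Definition tmap : {linear tensor V W -> tensor V' W'} := tlift tmap_bil.

Lemma tmapE v w : tmap (tens v w) = tens (f v) (g w).
Proof. exact: tliftE. Qed.

End Map.

Arguments tmap : simpl never.

Section Assoc.
Variables (V W X : lmodType k).

Definition tassoc_bil (t : tensor V W) (x : X) : tensor V (tensor W X) :=
  tmap idfun (applyr (@tens k W X) x) t.

Lemma tassoc_bilP : bilinear_for *:%R *:%R tassoc_bil.
Proof.
apply: bilinearI => [x a s t|t a x y]; rewrite /tassoc_bil ?linearP //.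
elim/tensor_ind: t => [|s t IHs IHt|v w].
- by rewrite !linear0 addr0.
- by rewrite !linearD IHs IHt addrACA.
by rewrite !tmapE /= !linearPr.
Qed.

HB.instance Definition _ :=
  bilinear_isBilinear.Build k (tensor V W) X _ _ _ tassoc_bil tassoc_bilP.

Definition tassoc : {linear tensor (tensor V W) X -> tensor V (tensor W X)} :=
  tlift tassoc_bil.

Lemma tassocE v w x : tassoc (tens (tens v w) x) = tens v (tens w x).
Proof. by rewrite /tassoc tliftE /= /tassoc_bil tmapE. Qed.

End Assoc.

Section MidSwap.
Variables (V W X Y : lmodType k).

Definition tmid_bil (t : tensor X Y) (v : V) (w : W) :
    tensor (tensor V X) (tensor W Y) :=
  tmap (tens v) (tens w) t.

Lemma tmid_bilP t : bilinear_for *:%R *:%R (tmid_bil t).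
Proof.
apply: bilinearI => [w a u v|v a u w]; rewrite /tmid_bil.
- elim/tensor_ind: t => [|s t IHs IHt|x y].
  + by rewrite !linear0 addr0.
  + by rewrite !linearD IHs IHt addrACA.
  by rewrite !tmapE /= linearPl linearPl.
elim/tensor_ind: t => [|s t IHs IHt|x y].
- by rewrite !linear0 addr0.
- by rewrite !linearD IHs IHt addrACA.
by rewrite !tmapE /= linearPl linearPr.
Qed.

HB.instance Definition _ t :=
  bilinear_isBilinear.Build k V W _ _ _ (tmid_bil t) (tmid_bilP t).

Definition tmid_fun (s : tensor V W) (t : tensor X Y) :
    tensor (tensor V X) (tensor W Y) :=
  tlift (tmid_bil t) s.

Lemma tmid_funP : bilinear_for *:%R *:%R tmid_fun.
Proof.
apply: bilinearI => [t a r s|r a t u]; rewrite /tmid_fun ?linearP //.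
elim/tensor_ind: r => [|r s IHr IHs|v w].
- by rewrite !linear0 addr0.
- by rewrite !linearD IHr IHs addrACA.
by rewrite !tliftE /= /tmid_bil linearP.
Qed.

HB.instance Definition _ :=
  bilinear_isBilinear.Build k (tensor V W) (tensor X Y) _ _ _
    tmid_fun tmid_funP.

Definition tmid : {linear tensor (tensor V W) (tensor X Y) ->
                          tensor (tensor V X) (tensor W Y)} :=
  tlift tmid_fun.

Lemma tmidE v w x y :
  tmid (tens (tens v w) (tens x y)) = tens (tens v x) (tens w y).
Proof. by rewrite /tmid tliftE /= /tmid_fun tliftE /= /tmid_bil tmapE. Qed.

End MidSwap.
End TensorMaps.

(* A finite set is encoded as a subset [A : {set U}] of a finite type [U]; the
   ambient type carries no information, since a bijection relates only the
   elements of the two subsets. *)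

Record bij (U V : finType) (A : {set U}) (B : {set V}) := Bij {
  bij_fun :> {x : U | x \in A} -> {y : V | y \in B};
  bij_bijective : bijective bij_fun
}.

Definition bij_id (U : finType) (A : {set U}) : bij A A :=
  @Bij U U A A id (inv_bij (fun=> erefl)).

Definition bij_trans (U V W : finType) (A : {set U}) (B : {set V}) (C : {set W})
    (t : bij B C) (s : bij A B) : bij A C :=
  Bij (bij_comp (bij_bijective t) (bij_bijective s)).

Record species (k : fieldType) := Species {
  sp_obj :> forall U : finType, {set U} -> lmodType k;
  sp_map : forall (U V : finType) (A : {set U}) (B : {set V}),
    bij A B -> {linear sp_obj A -> sp_obj B};
  sp_map_id : forall (U : finType) (A : {set U}) (x : sp_obj A),
    sp_map (bij_id A) x = x;
  sp_map_comp : forall (U V W : finType)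
      (A : {set U}) (B : {set V}) (C : {set W})
      (t : bij B C) (s : bij A B) (x : sp_obj A),
    sp_map (bij_trans t s) x = sp_map t (sp_map s x)
}.

Definition is_decomp (U : finType) (I S T : {set U}) : bool :=
  (S :|: T == I) && [disjoint S & T].

(* The ordered pairs [(S, T)] with [I = S |_| T]. *)
Definition decomp (U : finType) (I : {set U}) :=
  {ST : {set U} * {set U} | is_decomp I ST.1 ST.2}.

(* [s1] is the restriction of [s] to [S], for [S \subset A]. *)
Definition restricts (U V : finType) (S A : {set U}) (S' B : {set V})
    (s1 : bij S S') (s : bij A B) : Prop :=
  forall x y, val x = val y -> val (s1 x) = val (s y).

(* A morphism out of (into) the Cauchy product [p . p] is its family of
   components over the decompositions [I = S |_| T], and a morphism out of
   (into) the unit species is determined by its components at empty sets: the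
   fields below are the diagrams of the monoidal category, by components.  The
   structure maps take the equation [I = S |_| T] or [E = set0] as an argument,
   which avoids transport along equalities of sets. *)

Record monoid (k : fieldType) (p : species k) := Monoid {
  mon_mu : forall (U : finType) (I S T : {set U}),
    is_decomp I S T -> {linear tensor (p U S) (p U T) -> p U I};
  mon_iota : forall (U : finType) (E : {set U}),
    E == set0 -> {linear k^o -> p U E};

  mu_natural : forall (U V : finType)
      (I S T : {set U}) (J S' T' : {set V})
      (H : is_decomp I S T) (H' : is_decomp J S' T')
      (s : bij I J) (s1 : bij S S') (s2 : bij T T'),
    restricts s1 s -> restricts s2 s ->
    forall z, sp_map p s (mon_mu H z) =
              mon_mu H' (tmap (sp_map p s1) (sp_map p s2) z);
  iota_natural : forall (U V : finType) (E : {set U}) (E' : {set V})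
      (e : E == set0) (e' : E' == set0) (s : bij E E') (c : k^o),
    sp_map p s (mon_iota e c) = mon_iota e' c;

  mu_assoc : forall (U : finType) (I RS ST R S T : {set U})
      (H1 : is_decomp I RS T) (H2 : is_decomp RS R S)
      (H3 : is_decomp I R ST) (H4 : is_decomp ST S T)
      (z : tensor (tensor (p U R) (p U S)) (p U T)),
    mon_mu H1 (tmap (mon_mu H2) idfun z) =
    mon_mu H3 (tmap idfun (mon_mu H4) (tassoc _ _ _ z));
  mu_unitl : forall (U : finType) (I E : {set U})
      (e : E == set0) (H : is_decomp I E I) (x : p U I),
    mon_mu H (tens (mon_iota e 1) x) = x;
  mu_unitr : forall (U : finType) (I E : {set U})
      (e : E == set0) (H : is_decomp I I E) (x : p U I),
    mon_mu H (tens x (mon_iota e 1)) = x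
}.

Record comonoid (k : fieldType) (p : species k) := Comonoid {
  com_Delta : forall (U : finType) (I S T : {set U}),
    is_decomp I S T -> {linear p U I -> tensor (p U S) (p U T)};
  com_eps : forall (U : finType) (E : {set U}),
    E == set0 -> {linear p U E -> k^o};

  Delta_natural : forall (U V : finType)
      (I S T : {set U}) (J S' T' : {set V})
      (H : is_decomp I S T) (H' : is_decomp J S' T')
      (s : bij I J) (s1 : bij S S') (s2 : bij T T'),
    restricts s1 s -> restricts s2 s ->
    forall x, com_Delta H' (sp_map p s x) =
              tmap (sp_map p s1) (sp_map p s2) (com_Delta H x);
  eps_natural : forall (U V : finType) (E : {set U}) (E' : {set V})
      (e : E == set0) (e' : E' == set0) (s : bij E E') (x : p U E),
    com_eps e' (sp_map p s x) = com_eps e x;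

  Delta_coassoc : forall (U : finType) (I RS ST R S T : {set U})
      (H1 : is_decomp I RS T) (H2 : is_decomp RS R S)
      (H3 : is_decomp I R ST) (H4 : is_decomp ST S T) (x : p U I),
    tassoc _ _ _ (tmap (com_Delta H2) idfun (com_Delta H1 x)) =
    tmap idfun (com_Delta H4) (com_Delta H3 x);
  Delta_counitl : forall (U : finType) (I E : {set U})
      (e : E == set0) (H : is_decomp I E I) (x : p U I),
    tmap (com_eps e) idfun (com_Delta H x) = tens (1 : k^o) x;
  Delta_counitr : forall (U : finType) (I E : {set U})
      (e : E == set0) (H : is_decomp I I E) (x : p U I),
    tmap idfun (com_eps e) (com_Delta H x) = tens x (1 : k^o)
}.

(* The four laws say that product and unit are morphisms of comonoids.  In
   [bim_Delta_mu] the four inner decompositions force [A = S :&: S'],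
   [B = S :&: T'], [C = T :&: S'] and [D = T :&: T']. *)
Record bimonoid (k : fieldType) := Bimonoid {
  bim_species :> species k;
  bim_monoid : monoid bim_species;
  bim_comonoid : comonoid bim_species;

  bim_Delta_mu : forall (U : finType) (I S T S' T' A B C D : {set U})
      (H : is_decomp I S T) (H' : is_decomp I S' T')
      (HS : is_decomp S A B) (HT : is_decomp T C D)
      (HS' : is_decomp S' A C) (HT' : is_decomp T' B D)
      (z : tensor (bim_species U S) (bim_species U T)),
    com_Delta bim_comonoid H' (mon_mu bim_monoid H z) =
    tmap (mon_mu bim_monoid HS') (mon_mu bim_monoid HT')
      (tmid _ _ _ _
        (tmap (com_Delta bim_comonoid HS) (com_Delta bim_comonoid HT) z));
  bim_eps_mu : forall (U : finType) (E E1 E2 : {set U})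
      (H : is_decomp E E1 E2)
      (e : E == set0) (e1 : E1 == set0) (e2 : E2 == set0)
      (x : bim_species U E1) (y : bim_species U E2),
    com_eps bim_comonoid e (mon_mu bim_monoid H (tens x y)) =
    (com_eps bim_comonoid e1 x : k) * (com_eps bim_comonoid e2 y : k);
  bim_Delta_iota : forall (U : finType) (E E1 E2 : {set U})
      (H : is_decomp E E1 E2)
      (e : E == set0) (e1 : E1 == set0) (e2 : E2 == set0),
    com_Delta bim_comonoid H (mon_iota bim_monoid e 1) =
    tens (mon_iota bim_monoid e1 1) (mon_iota bim_monoid e2 1);
  bim_eps_iota : forall (U : finType) (E : {set U}) (e : E == set0) (c : k^o),
    com_eps bim_comonoid e (mon_iota bim_monoid e c) = c
}.

Definition has_dim (k : fieldType) (V : lmodType k) (n : nat) : Prop :=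
  exists b : 'I_n -> V,
    forall x : V, exists! c : {ffun 'I_n -> k}, x = \sum_i c i *: b i.

Definition connected (k : fieldType) (h : bimonoid k) : Prop :=
  forall U : finType, has_dim (h U set0) 1.

Section Convolution.
Variables (k : fieldType) (h : bimonoid k).

Local Notation mu H := (mon_mu (bim_monoid h) H).
Local Notation iota e := (mon_iota (bim_monoid h) e).
Local Notation Delta H := (com_Delta (bim_comonoid h) H).
Local Notation eps e := (com_eps (bim_comonoid h) e).

Definition endo := forall (U : finType) (I : {set U}), {linear h U I -> h U I}.

Definition endo_natural (f : endo) : Prop :=
  forall (U V : finType) (A : {set U}) (B : {set V}) (s : bij A B) (x : h U A),
    sp_map h s (f U A x) = f V B (sp_map h s x).

Definition conv_fun (f g : endo) (U : finType) (I : {set U}) (x : h U I) :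
    h U I :=
  \sum_(d : decomp I)
    mu (valP d) (tmap (f U (val d).1) (g U (val d).2) (Delta (valP d) x)).

Lemma conv_fun_is_linear f g U I : linear (@conv_fun f g U I).
Proof.
move=> a x y; rewrite /conv_fun scaler_sumr -big_split /=.
by apply: eq_bigr => d _; rewrite !linearP.
Qed.

HB.instance Definition _ f g U I :=
  GRing.isLinear.Build k (h U I) (h U I) _ (@conv_fun f g U I)
    (@conv_fun_is_linear f g U I).

Definition conv (f g : endo) : endo := fun U I => @conv_fun f g U I.

Definition endo_id : endo := fun U I => idfun.

Definition endo_unit : endo := fun U I =>
  match @idP (I == set0) with
  | ReflectT e => iota e \o eps e
  | ReflectF _ => \0
  end.

Definition is_antipode (S : endo) : Prop :=
  [/\ endo_natural S,
      forall (U : finType) (I : {set U}),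
        conv S endo_id I =1 endo_unit I
    & forall (U : finType) (I : {set U}),
        conv endo_id S I =1 endo_unit I].

(* The convolution inverse of the identity, which is unique when it exists;
   a dummy value when there is none. *)
Definition antipode : endo :=
  if pselect (exists S : endo, is_antipode S) is left exS
  then sval (cid exS) else endo_unit.

Definition number_op_fun (U : finType) (I : {set U}) (x : h U I) : h U I :=
  #|I|%:R *: x.

Lemma number_op_fun_is_linear U I : linear (@number_op_fun U I).
Proof. by move=> a x y; rewrite /number_op_fun scalerDr !scalerA mulrC. Qed.

HB.instance Definition _ U I :=
  GRing.isLinear.Build k (h U I) (h U I) _ (@number_op_fun U I)
    (@number_op_fun_is_linear U I).

Definition number_op : endo := fun U I => @number_op_fun U I.

End Convolution.

Section Compositions.
Variable U : finType.
Implicit Types (I A : {set U}) (F : seq {set U}).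

Definition is_comp I F : bool :=
  [&& set0 \notin F, pairwise (fun A B => [disjoint A & B]) F
    & \bigcup_(A <- F) A == I].

(* The bound on the length holds for every composition of [I]; it makes the
   type visibly finite. *)
Definition composition I := {F : #|I|.-bseq {set U} | is_comp I F}.

Definition last_block F : {set U} := last set0 F.

Lemma is_comp_size I F : is_comp I F -> (size F <= #|I|)%N.
Proof.
elim: F I => //= A F IHF I /and3P[/=]; rewrite inE negb_or => /andP[A0 F0].
case/andP=> /allP AF disF /eqP <-; rewrite big_cons.
have dAF : [disjoint A & \bigcup_(B <- F) B].
  rewrite -setI_eq0 big_distrr /=; apply/eqP.
  by rewrite big1_seq // => B /andP[_ /AF]; rewrite -setI_eq0 => /eqP.
rewrite cardsU (disjoint_setI0 dAF) cards0 subn0 -add1n leq_add //.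
  by rewrite card_gt0 eq_sym.
by apply: IHF; rewrite /is_comp F0 disF /=.
Qed.

Lemma is_comp_nil I : is_comp I [::] -> I == set0.
Proof. by case/and3P=> _ _; rewrite big_nil eq_sym. Qed.

Lemma is_comp_single I A : is_comp I [:: A] -> A = I.
Proof. by case/and3P=> _ _ /eqP; rewrite big_seq1. Qed.

Lemma is_comp_cons I A F : is_comp I (A :: F) ->
  is_decomp I A (I :\: A) /\ is_comp (I :\: A) F.
Proof.
case/and3P=> /=; rewrite inE negb_or => /andP[A0 F0] /andP[/allP AF disF].
move/eqP=> <-; rewrite big_cons; set B := \bigcup_(_ <- _) _.
have dAB : [disjoint A & B].
  rewrite -setI_eq0 big_distrr /=; apply/eqP.
  by rewrite big1_seq // => C /andP[_ /AF]; rewrite -setI_eq0 => /eqP.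
have -> : (A :|: B) :\: A = B.
  by rewrite setDUl setDv set0U; apply/setDidPl; rewrite disjoint_sym.
by rewrite /is_decomp /is_comp eqxx dAB F0 disF /=.
Qed.

End Compositions.

Section Sigma.
Variables (k : fieldType) (U : finType).

Definition Sigma (I : {set U}) : lmodType k := {ffun composition I -> k^o}.

Definition H_basis (I : {set U}) (F : composition I) : Sigma I :=
  [ffun G => (G == F)%:R].

Definition dynkin (I : {set U}) : Sigma I :=
  if I == set0 then 0
  else \sum_(F : composition I)
         ((-1) ^+ (size (val F)).-1 * #|last_block (val F)|%:R : k)
           *: H_basis F.

End Sigma.

Section Iterated.
Variables (k : fieldType) (h : bimonoid k) (U : finType).

Local Notation mu H := (mon_mu (bim_monoid h) H).
Local Notation iota e := (mon_iota (bim_monoid h) e).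
Local Notation Delta H := (com_Delta (bim_comonoid h) H).
Local Notation eps e := (com_eps (bim_comonoid h) e).

(* [h[I_1] (x) (h[I_2] (x) (... (x) h[I_k]))]; the ground field if [k = 0]. *)
Fixpoint tens_seq (F : seq {set U}) : lmodType k :=
  match F with
  | [::] => k^o
  | A :: F' =>
    match F' with [::] => h U A | _ => tensor (h U A) (tens_seq F') end
  end.

Definition cast_lin (A B : {set U}) (e : A = B) : {linear h U A -> h U B} :=
  ecast C {linear h U A -> h U C} e idfun.

(* For a single block, [cast_lin] is the identity, up to [A = I]. *)
Fixpoint mu_seq (F : seq {set U}) :
    forall I : {set U}, is_comp I F -> {linear tens_seq F -> h U I} :=
  match F return forall I, is_comp I F -> {linear tens_seq F -> h U I} with
  | [::] => fun I c => iota (is_comp_nil c)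
  | A :: F' =>
    match F' return
      (forall J, is_comp J F' -> {linear tens_seq F' -> h U J}) ->
      forall I, is_comp I (A :: F') -> {linear tens_seq (A :: F') -> h U I}
    with
    | [::] => fun _ I c => cast_lin (is_comp_single c)
    | B :: F'' => fun mu_tail I c =>
        mu (is_comp_cons c).1
          \o tmap idfun (mu_tail (I :\: A) (is_comp_cons c).2)
    end (@mu_seq F')
  end.

Fixpoint Delta_seq (F : seq {set U}) :
    forall I : {set U}, is_comp I F -> {linear h U I -> tens_seq F} :=
  match F return forall I, is_comp I F -> {linear h U I -> tens_seq F} with
  | [::] => fun I c => eps (is_comp_nil c)
  | A :: F' =>
    match F' return
      (forall J, is_comp J F' -> {linear h U J -> tens_seq F'}) ->
      forall I, is_comp I (A :: F') -> {linear h U I -> tens_seq (A :: F')}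
    with
    | [::] => fun _ I c => cast_lin (esym (is_comp_single c))
    | B :: F'' => fun Delta_tail I c =>
        tmap idfun (Delta_tail (I :\: A) (is_comp_cons c).2)
          \o Delta (is_comp_cons c).1
    end (@Delta_seq F')
  end.

Definition Psi_fun (I : {set U}) (z : Sigma k I) (x : h U I) : h U I :=
  \sum_(F : composition I) z F *: mu_seq (valP F) (Delta_seq (valP F) x).

Lemma Psi_fun_is_linear I z : linear (@Psi_fun I z).
Proof.
move=> a x y; rewrite /Psi_fun scaler_sumr -big_split /=.
by apply: eq_bigr => F _; rewrite 2!linearP scalerDr !scalerA mulrC.
Qed.

HB.instance Definition _ I z :=
  GRing.isLinear.Build k (h U I) (h U I) _ (@Psi_fun I z)
    (@Psi_fun_is_linear I z).

End Iterated.

Definition series (k : fieldType) :=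
  forall (U : finType) (I : {set U}), Sigma k I.

Definition Psi (k : fieldType) (h : bimonoid k) (s : series k) : endo h :=
  fun U I => Psi_fun (s U I).

(* Main.v *)
(* Splitting off the first block of a composition gives id * Psi(D) = N for the
   convolution product: the terms where the first factor is proper cancel
   against the compositions of length at least 2, and the composition (I) leaves
   |I| id.  Convolving with S on the left yields Psi(D) = S * N.  The
   antipode is Takeuchi's alternating series of the convolution powers of
   id - u, which is finite on each component since connectedness makes
   id - u vanish at the empty set. *)

Require Import Defs.
From HB Require Import structures.
From mathcomp Require Import all_boot all_order all_algebra.
From mathcomp Require Import boolp.

Set Implicit Arguments.
Unset Strict Implicit.
Unset Printing Implicit Defensive.

Import GRing.Theory.
Local Open Scope ring_scope.

(** * Tensor products of linear maps: functoriality, linearity, associativity *)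

Section TensorMapLemmas.
Variable k : fieldType.

Lemma eq_tmap (V W V' W' : lmodType k) (f f' : {linear V -> V'})
    (g g' : {linear W -> W'}) :
  f =1 f' -> g =1 g' -> tmap f g =1 tmap f' g'.
Proof. by move=> ff' gg'; apply: tens_ext => v w; rewrite !tmapE ff' gg'. Qed.

Lemma tmap_comp (V W V' W' V'' W'' : lmodType k)
    (f : {linear V -> V'}) (g : {linear W -> W'})
    (f' : {linear V' -> V''}) (g' : {linear W' -> W''}) z :
  tmap f' g' (tmap f g z) = tmap (f' \o f) (g' \o g) z.
Proof.
suff: (tmap f' g' \o tmap f g) =1 tmap (f' \o f) (g' \o g) by apply.
by apply: tens_ext => v w /=; rewrite !tmapE.
Qed.

(** The combination is given pointwise and over an arbitrary list, so that one lemma serves sums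
    over decompositions, over powers and over the two summands of the identity; the empty list
    yields [tmap0l]. *)
Lemma tmap_suml (V W V' W' : lmodType k) (T : Type) (r : seq T) (c : T -> k)
    (f : {linear V -> V'}) (F : T -> {linear V -> V'}) (g : {linear W -> W'})
    z :
    (forall x, f x = \sum_(i <- r) c i *: F i x) ->
  tmap f g z = \sum_(i <- r) c i *: tmap (F i) g z.
Proof.
move=> fE; elim/tensor_ind: z => [|x y IHx IHy|v w].
- by rewrite linear0 big1 // => i _; rewrite linear0 scaler0.
- rewrite linearD IHx IHy -big_split; apply: eq_bigr => i _ /=.
  by rewrite linearD scalerDr.
rewrite tmapE fE linear_sumlz; apply: eq_bigr => i _.
by rewrite tmapE linearZl_LR.
Qed.

Lemma tmap_sumr (V W V' W' : lmodType k) (T : Type) (r : seq T) (c : T -> k)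
    (f : {linear V -> V'}) (g : {linear W -> W'}) (G : T -> {linear W -> W'})
    z :
    (forall x, g x = \sum_(i <- r) c i *: G i x) ->
  tmap f g z = \sum_(i <- r) c i *: tmap f (G i) z.
Proof.
move=> gE; elim/tensor_ind: z => [|x y IHx IHy|v w].
- by rewrite linear0 big1 // => i _; rewrite linear0 scaler0.
- rewrite linearD IHx IHy -big_split; apply: eq_bigr => i _ /=.
  by rewrite linearD scalerDr.
rewrite tmapE gE linear_sum; apply: eq_bigr => i _.
by rewrite tmapE linearZ.
Qed.

Lemma tmap0l (V W V' W' : lmodType k) (f : {linear V -> V'})
    (g : {linear W -> W'}) z : (forall x, f x = 0) -> tmap f g z = 0.
Proof.
move=> f0; rewrite (@tmap_suml _ _ _ _ k [::] (fun=> 0) _ (fun=> f)).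
  by rewrite big_nil.
by move=> x; rewrite big_nil.
Qed.

Lemma tmap0r (V W V' W' : lmodType k) (f : {linear V -> V'})
    (g : {linear W -> W'}) z : (forall x, g x = 0) -> tmap f g z = 0.
Proof.
move=> g0; rewrite (@tmap_sumr _ _ _ _ k [::] (fun=> 0) _ _ (fun=> g)).
  by rewrite big_nil.
by move=> x; rewrite big_nil.
Qed.

Lemma tassoc_tmap (V W X V' W' X' : lmodType k) (f : {linear V -> V'})
    (g : {linear W -> W'}) (h : {linear X -> X'}) z :
  tassoc _ _ _ (tmap (tmap f g) h z) = tmap f (tmap g h) (tassoc _ _ _ z).
Proof.
elim/tensor_ind: z => [|y z IHy IHz|t x]; first by rewrite !linear0.
  by rewrite !linearD IHy IHz.
rewrite tmapE; elim/tensor_ind: t => [|s t IHs IHt|v w].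
- by rewrite linear0 !linear0l !linear0.
- by rewrite linearD !linearDl !linearD IHs IHt.
by rewrite !tmapE !tassocE !tmapE.
Qed.

End TensorMapLemmas.

(** * Sums over decompositions of a finite set *)

Section When.
Variables (M : nmodType) (b : bool) (F : b -> M).

(** Extension by zero: a term that needs a proof of [b] can then be summed over indices for which
    [b] may fail. *)
Definition when : M :=
  match @idP b with ReflectT Hb => F Hb | ReflectF _ => 0 end.

Lemma whenT (Hb : b) : when = F Hb.
Proof.
rewrite /when; case: {-}_ / idP => // H.
by congr F; apply: bool_irrelevance.
Qed.

Lemma whenF : ~~ b -> when = 0.
Proof.
by move=> nb; rewrite /when; case: {-}_ / idP => // H; rewrite H in nb.
Qed.

End When.

Section Decompositions.
Variable U : finType.
Implicit Types I S T : {set U}.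

Lemma decomp_subl I S T : is_decomp I S T -> S \subset I.
Proof. by case/andP=> /eqP <- _; apply: subsetUl. Qed.

Lemma decomp_subr I S T : is_decomp I S T -> T \subset I.
Proof. by case/andP=> /eqP <- _; apply: subsetUr. Qed.

Lemma card_decomp I S T : is_decomp I S T -> #|I| = (#|S| + #|T|)%N.
Proof.
by case/andP=> /eqP <- /disjoint_setI0 ST0; rewrite cardsU ST0 cards0 subn0.
Qed.

Lemma decompE I S T : is_decomp I S T = (S \subset I) && (T == I :\: S).
Proof.
apply/idP/andP=> [H|[SI /eqP->]].
  split; first exact: decomp_subl H.
  case/andP: H => /eqP <- dST; rewrite setDUl setDv set0U eq_sym.
  by apply/eqP/setDidPl; rewrite disjoint_sym.
rewrite /is_decomp -{1}(setIidPr SI) setID eqxx /= -setI_eq0.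
by rewrite setIDA [S :&: I]setIC -setIDA setDv setI0.
Qed.

Lemma decompDl I S : S \subset I -> is_decomp I S (I :\: S).
Proof. by move=> SI; rewrite decompE SI eqxx. Qed.

Lemma decomp0 I : is_decomp I set0 I.
Proof. by rewrite decompE sub0set setD0 eqxx. Qed.

Lemma decompr0 I : is_decomp I I set0.
Proof. by rewrite decompE subxx setDv eqxx. Qed.

(** Either side says that R, S, T are pairwise disjoint with union I. *)
Lemma decompA I R S T :
  is_decomp I (R :|: S) T && is_decomp (R :|: S) R S =
  is_decomp I R (S :|: T) && is_decomp (S :|: T) S T.
Proof.
rewrite /is_decomp !eqxx /= setUA -!setI_eq0 setIUl setIUr !setU_eq0.
by case: (_ == I); case: (R :&: S == _); case: (R :&: T == _);
  case: (S :&: T == _).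
Qed.

(* The sum over decompositions as a sum over all pairs of sets, so that the
   indices of iterated sums no longer depend on one another. *)
Lemma big_decomp (M : nmodType) I
    (G : forall S T, is_decomp I S T -> M) :
  \sum_(d : decomp I) G _ _ (valP d) =
  \sum_S \sum_T when (G S T).
Proof.
rewrite pair_big /=.
rewrite (bigID (fun p => is_decomp I p.1 p.2)) /= [X in _ + X]big1 ?addr0.
  rewrite (big_sub (fun p => is_decomp I p.1 p.2)) /=.
  by apply: eq_bigr => d _; rewrite (whenT _ (valP d)).
by move=> p; apply: whenF.
Qed.

(** Testing the first set is enough, since the second is its complement in I. *)
Lemma big_decomp1 (M : nmodType) I S0 T0 (H0 : is_decomp I S0 T0)
    (G : forall S T, is_decomp I S T -> M) :
    (forall S T (H : is_decomp I S T), S != S0 -> G S T H = 0) ->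
  \sum_(d : decomp I) G _ _ (valP d) = G _ _ H0.
Proof.
move=> G0; rewrite (bigD1 (exist _ (S0, T0) H0 : decomp I)) //= big1 ?addr0.
  by congr G; apply: bool_irrelevance.
move=> [[S T] /= H] neq; apply: G0; apply: contraNneq neq => eqS.
subst S; rewrite -val_eqE /= /eq_op /= eqxx /=.
move: (H) (H0); rewrite !decompE => /andP[_ /eqP->] /andP[_ /eqP->].
exact: eqxx.
Qed.

End Decompositions.

(** * The convolution algebra of endomorphisms *)

Section ConvolutionAlgebra.
Variables (k : fieldType) (h : bimonoid k).

Local Notation mu H := (mon_mu (bim_monoid h) H).
Local Notation iota e := (mon_iota (bim_monoid h) e).
Local Notation Delta H := (com_Delta (bim_comonoid h) H).
Local Notation eps e := (com_eps (bim_comonoid h) e).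

(* The summand of [conv f g] at a decomposition, as a linear map so that it can
   itself be tensored.  The lemmas below avoid [/=], which would unfold it. *)
Definition conv_at (U : finType) (I S T : {set U})
    (f : {linear h U S -> h U S}) (g : {linear h U T -> h U T})
    (H : is_decomp I S T) : {linear h U I -> h U I} :=
  mu H \o (tmap f g \o Delta H).

Lemma conv_atE (U : finType) (I S T : {set U})
    (f : {linear h U S -> h U S}) (g : {linear h U T -> h U T})
    (H : is_decomp I S T) x :
  conv_at f g H x = mu H (tmap f g (Delta H x)).
Proof. by []. Qed.

Lemma convE (f g : endo h) (U : finType) (I : {set U}) (x : h U I) :
  conv f g I x =
  \sum_(d : decomp I) conv_at (f U (val d).1) (g U (val d).2) (valP d) x.
Proof. by []. Qed.

Lemma eq_conv (f f' g g' : endo h) (U : finType) (I : {set U}) (x : h U I) :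
    (forall S : {set U}, S \subset I -> f U S =1 f' U S) ->
    (forall S : {set U}, S \subset I -> g U S =1 g' U S) ->
  conv f g I x = conv f' g' I x.
Proof.
move=> ff' gg'; rewrite !convE; apply: eq_bigr => d _; rewrite !conv_atE.
congr (mu _ _); apply: eq_tmap => [y|y].
  by apply: ff'; apply: decomp_subl (valP d).
by apply: gg'; apply: decomp_subr (valP d).
Qed.

(** The expansion is required only on subsets of I: the series for the antipode has a common finite
    truncation there, but not on all finite sets at once. *)
Lemma conv_suml (T : Type) (r : seq T) (c : T -> k) (f : endo h)
    (F : T -> endo h) (g : endo h) (U : finType) (I : {set U}) (x : h U I) :
    (forall S : {set U}, S \subset I ->
      forall y, f U S y = \sum_(i <- r) c i *: F i U S y) ->
  conv f g I x = \sum_(i <- r) c i *: conv (F i) g I x.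
Proof.
move=> fE; under [RHS]eq_bigr do rewrite convE scaler_sumr.
rewrite convE exchange_big; apply: eq_bigr => d _ /=.
rewrite (tmap_suml _ _ (fE _ _)); last exact: decomp_subl (valP d).
by rewrite linear_sum; apply: eq_bigr => i _; rewrite linearZ.
Qed.

Lemma conv_sumr (T : Type) (r : seq T) (c : T -> k) (f : endo h)
    (g : endo h) (G : T -> endo h) (U : finType) (I : {set U}) (x : h U I) :
    (forall S : {set U}, S \subset I ->
      forall y, g U S y = \sum_(i <- r) c i *: G i U S y) ->
  conv f g I x = \sum_(i <- r) c i *: conv f (G i) I x.
Proof.
move=> gE; under [RHS]eq_bigr do rewrite convE scaler_sumr.
rewrite convE exchange_big; apply: eq_bigr => d _ /=.
rewrite (tmap_sumr _ _ (gE _ _)); last exact: decomp_subr (valP d).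
by rewrite linear_sum; apply: eq_bigr => i _; rewrite linearZ.
Qed.

Lemma endo_unitE (U : finType) (I : {set U}) (e : I == set0) x :
  endo_unit h I x = iota e (eps e x).
Proof.
rewrite /endo_unit; case: {-}_ / idP => // e'.
by rewrite (bool_irrelevance e' e).
Qed.

Lemma endo_unit0 (U : finType) (I : {set U}) x :
  I != set0 -> endo_unit h I x = 0.
Proof.
by move=> I0; rewrite /endo_unit; case: {-}_ / idP => // e; rewrite e in I0.
Qed.

Lemma conv_unitl (f : endo h) (U : finType) (I : {set U}) (x : h U I) :
  conv (endo_unit h) f I x = f U I x.
Proof.
rewrite convE (big_decomp1 (decomp0 I)
  (G := fun S T H => conv_at (endo_unit h S) (f U T) H x)); last first.
  move=> S T H S0; rewrite conv_atE tmap0l ?linear0 // => y.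
  exact: endo_unit0.
have e0 : (set0 : {set U}) == set0 by [].
(* The unit factors as [iota] after [eps]; peeling off [eps] first exposes the counit law, and then
   the unit law. *)
have -> : conv_at (endo_unit h set0) (f U I) (decomp0 I) x =
    mu (decomp0 I)
      (tmap (iota e0) (f U I) (tmap (eps e0) idfun (Delta (decomp0 I) x))).
  rewrite conv_atE tmap_comp; congr (mu _ _).
  by apply: eq_tmap => // y; apply: endo_unitE.
by rewrite Delta_counitl tmapE mu_unitl.
Qed.

Lemma conv_unitr (f : endo h) (U : finType) (I : {set U}) (x : h U I) :
  conv f (endo_unit h) I x = f U I x.
Proof.
rewrite convE (big_decomp1 (decompr0 I)
  (G := fun S T H => conv_at (f U S) (endo_unit h T) H x)); last first.
  move=> S T H SI; rewrite conv_atE tmap0r ?linear0 // => y.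
  (* If the second set is empty, the first one is I. *)
  apply: endo_unit0; apply: contraNneq SI => T0; subst T.
  by case/andP: H; rewrite setU0.
have e0 : (set0 : {set U}) == set0 by [].
have -> : conv_at (f U I) (endo_unit h set0) (decompr0 I) x =
    mu (decompr0 I)
      (tmap (f U I) (iota e0) (tmap idfun (eps e0) (Delta (decompr0 I) x))).
  rewrite conv_atE tmap_comp; congr (mu _ _).
  by apply: eq_tmap => // y; apply: endo_unitE.
by rewrite Delta_counitr tmapE mu_unitr.
Qed.

Lemma conv_at_sum (f g l : endo h) (U : finType) (I S T : {set U})
    (H : is_decomp I S T) x :
  conv_at (conv f g S) (l U T) H x =
  \sum_(d : decomp S)
    conv_at (conv_at (f U (val d).1) (g U (val d).2) (valP d)) (l U T) H x.
Proof.
rewrite conv_atE.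
rewrite (@tmap_suml _ _ _ _ _ _ (index_enum (decomp S)) (fun=> 1) _
  (fun d => conv_at (f U (val d).1) (g U (val d).2) (valP d))).
  by rewrite linear_sum; apply: eq_bigr => d _; rewrite scale1r.
by move=> y; rewrite convE; apply: eq_bigr => d _; rewrite scale1r.
Qed.

Lemma conv_at_sumr (f g l : endo h) (U : finType) (I S T : {set U})
    (H : is_decomp I S T) x :
  conv_at (f U S) (conv g l T) H x =
  \sum_(d : decomp T)
    conv_at (f U S) (conv_at (g U (val d).1) (l U (val d).2) (valP d)) H x.
Proof.
rewrite conv_atE.
rewrite (@tmap_sumr _ _ _ _ _ _ (index_enum (decomp T)) (fun=> 1) _ _
  (fun d => conv_at (g U (val d).1) (l U (val d).2) (valP d))).
  by rewrite linear_sum; apply: eq_bigr => d _; rewrite scale1r.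
by move=> y; rewrite convE; apply: eq_bigr => d _; rewrite scale1r.
Qed.

(** Each side splits into coproducts, then a tensor product of three maps, then products.
    Coassociativity and associativity match the outer layers, and the associator passes through the
    middle one. *)
Lemma conv_atA (U : finType) (I RS ST R S T : {set U})
    (H1 : is_decomp I RS T) (H2 : is_decomp RS R S)
    (H3 : is_decomp I R ST) (H4 : is_decomp ST S T)
    (f : {linear h U R -> h U R}) (g : {linear h U S -> h U S})
    (l : {linear h U T -> h U T}) x :
  conv_at (conv_at f g H2) l H1 x = conv_at f (conv_at g l H4) H3 x.
Proof.
rewrite !conv_atE.
have -> z : tmap (conv_at f g H2) l z =
    tmap (mu H2) idfun (tmap (tmap f g) l (tmap (Delta H2) idfun z)).
  by rewrite !tmap_comp; apply: eq_tmap.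
have -> z : tmap f (conv_at g l H4) z =
    tmap idfun (mu H4) (tmap f (tmap g l) (tmap idfun (Delta H4) z)).
  by rewrite !tmap_comp; apply: eq_tmap.
by rewrite (mu_assoc _ _ _ H3 H4) tassoc_tmap (Delta_coassoc _ _ _ H3 H4).
Qed.

(** Both sides are sums over triples of pairwise disjoint sets with union I. Summing over all sets,
    with zero terms at invalid indices, allows the sums to be exchanged freely before the terms are
    compared. *)
Lemma convA (f g l : endo h) (U : finType) (I : {set U}) (x : h U I) :
  conv (conv f g) l I x = conv f (conv g l) I x.
Proof.
pose L RS R S T := when (fun H1 : is_decomp I RS T =>
  when (fun H2 : is_decomp RS R S =>
    conv_at (conv_at (f U R) (g U S) H2) (l U T) H1 x)).
pose M ST R S T := when (fun H3 : is_decomp I R ST =>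
  when (fun H4 : is_decomp ST S T =>
    conv_at (f U R) (conv_at (g U S) (l U T) H4) H3 x)).
have LE : conv (conv f g) l I x = \sum_RS \sum_T \sum_R \sum_S L RS R S T.
  rewrite convE (big_decomp (fun S T H => conv_at (conv f g S) (l U T) H x)).
  apply: eq_bigr => RS _; apply: eq_bigr => T _.
  have /orP[H1|H1] := orbN (is_decomp I RS T); last first.
    rewrite (whenF _ H1) big1 // => R _.
    by rewrite big1 // => S _; apply: whenF.
  rewrite (whenT _ H1).
  under [RHS]eq_bigr do under eq_bigr do rewrite /L (whenT _ H1).
  by rewrite conv_at_sum (big_decomp (fun R S H2 =>
    conv_at (conv_at (f U R) (g U S) H2) (l U T) H1 x)).
have ME : conv f (conv g l) I x = \sum_R \sum_ST \sum_S \sum_T M ST R S T.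
  rewrite convE (big_decomp (fun S T H => conv_at (f U S) (conv g l T) H x)).
  apply: eq_bigr => R _; apply: eq_bigr => ST _.
  have /orP[H3|H3] := orbN (is_decomp I R ST); last first.
    rewrite (whenF _ H3) big1 // => S _.
    by rewrite big1 // => T _; apply: whenF.
  rewrite (whenT _ H3).
  under [RHS]eq_bigr do under eq_bigr do rewrite /M (whenT _ H3).
  by rewrite conv_at_sumr (big_decomp (fun S T H4 =>
    conv_at (f U R) (conv_at (g U S) (l U T) H4) H3 x)).
(* The intermediate set is determined by the triple, so its sum collapses; likewise for [ST]
   below. *)
have L1 R S T : \sum_RS L RS R S T = L (R :|: S) R S T.
  rewrite (bigD1 (R :|: S)) //= big1 ?addr0 // => RS neq; rewrite /L.
  have /orP[H1|/whenF->//] := orbN (is_decomp I RS T).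
  rewrite (whenT _ H1); apply: whenF.
  by rewrite negb_and eq_sym neq.
have M1 R S T : \sum_ST M ST R S T = M (S :|: T) R S T.
  rewrite (bigD1 (S :|: T)) //= big1 ?addr0 // => ST neq; rewrite /M.
  have /orP[H3|/whenF->//] := orbN (is_decomp I R ST).
  rewrite (whenT _ H3); apply: whenF.
  by rewrite negb_and eq_sym neq.
transitivity (\sum_R \sum_S \sum_T \sum_RS L RS R S T).
  rewrite LE; under eq_bigr do rewrite exchange_big.
  rewrite exchange_big; apply: eq_bigr => R _ /=.
  under eq_bigr do rewrite exchange_big.
  rewrite exchange_big; apply: eq_bigr => S _ /=.
  by rewrite exchange_big.
rewrite ME; apply: eq_bigr => R _.
rewrite [RHS]exchange_big; apply: eq_bigr => S _.
rewrite [RHS]exchange_big; apply: eq_bigr => T _; rewrite L1 M1 /L /M.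
have /orP[/andP[H1 H2]|] :=
  orbN (is_decomp I (R :|: S) T && is_decomp (R :|: S) R S).
  have /andP[H3 H4] : is_decomp I R (S :|: T) && is_decomp (S :|: T) S T.
    by rewrite -decompA H1.
  rewrite (whenT _ H1) (whenT _ H2) (whenT _ H3) (whenT _ H4).
  exact: conv_atA.
(* At an invalid triple both terms vanish: by [decompA] the conditions on the two sides fail
   together. *)
move=> nLR; transitivity (0 : h U I).
  have /orP[H1|/whenF->//] := orbN (is_decomp I (R :|: S) T).
  rewrite (whenT _ H1).
  by apply: whenF; rewrite H1 in nLR.
rewrite decompA in nLR.
have /orP[H3|/whenF->//] := orbN (is_decomp I R (S :|: T)).
rewrite (whenT _ H3).
by apply: esym; apply: whenF; rewrite H3 in nLR.
Qed.

End ConvolutionAlgebra.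

(** * Transport of subsets and decompositions along bijections *)

Section BijectionImages.

(** Elements of [S] outside [A] are ignored, because [s] acts on the subtype of [A] only. *)
Definition bij_image (U V : finType) (A : {set U}) (B : {set V}) (s : bij A B)
    (S : {set U}) : {set V} :=
  [set val (s x) | x : {x : U | x \in A} & val x \in S].

Lemma mem_bij_image (U V : finType) (A : {set U}) (B : {set V}) (s : bij A B)
    (S : {set U}) x : (val (s x) \in bij_image s S) = (val x \in S).
Proof.
apply/imsetP/idP => [[y]|xS]; last by exists x; rewrite ?inE.
rewrite inE => yS /val_inj sxy.
by rewrite (bij_inj (bij_bijective s) sxy).
Qed.

Lemma bij_image_sub (U V : finType) (A : {set U}) (B : {set V}) (s : bij A B)
    (S : {set U}) : bij_image s S \subset B.
Proof. by apply/subsetP => y /imsetP[x _ ->]; apply: valP. Qed.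

Lemma bij_inverse (U V : finType) (A : {set U}) (B : {set V}) (s : bij A B) :
  exists t : bij B A, cancel s t /\ cancel t s.
Proof.
have [t st ts] := bij_bijective s.
by exists (Bij (Bijective ts st)).
Qed.

Lemma bij_imageK (U V : finType) (A : {set U}) (B : {set V}) (s : bij A B)
    (t : bij B A) (S : {set U}) :
  cancel s t -> cancel t s -> S \subset A -> bij_image t (bij_image s S) = S.
Proof.
move=> st ts SA; apply/setP => x; apply/idP/idP => [xS|xS].
  have xA := subsetP (bij_image_sub t _) _ xS.
  pose y : {x : U | x \in A} := exist _ x xA; move: xS.
  by rewrite -[x]/(val y) -(st y) !mem_bij_image st.
pose y : {x : U | x \in A} := exist _ x (subsetP SA x xS); move: (xS).
by rewrite -[x]/(val y) -(st y) !mem_bij_image st.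
Qed.

(** Provides the restricted bijections that the naturality axioms of product and coproduct take as
    arguments. *)
Lemma bij_restrict (U V : finType) (A : {set U}) (B : {set V}) (s : bij A B)
    (S : {set U}) : S \subset A ->
  exists s1 : bij S (bij_image s S), restricts s1 s.
Proof.
move=> SA; have [t [st ts]] := bij_inverse s.
have sP (x : {x | x \in S}) :
    val (s (exist _ (val x) (subsetP SA _ (valP x)))) \in bij_image s S.
  by rewrite mem_bij_image; exact: (valP x).
have tP (y : {y | y \in bij_image s S}) :
    val (t (exist _ (val y) (subsetP (bij_image_sub s S) _ (valP y)))) \in S.
  by rewrite -(mem_bij_image s) ts; exact: (valP y).
pose f (x : {x | x \in S}) : {y | y \in bij_image s S} :=
  exist (fun y => y \in bij_image s S) _ (sP x).
pose g (y : {y | y \in bij_image s S}) : {x | x \in S} :=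
  exist (fun x => x \in S) _ (tP y).
have fK : cancel f g.
  move=> x; apply: val_inj => /=.
  rewrite -[RHS]/(val (exist (fun x => x \in A) _ (subsetP SA _ (valP x)))).
  by congr val; rewrite -[RHS]st; congr (t _); apply: val_inj.
have gK : cancel g f.
  move=> y; apply: val_inj => /=.
  rewrite -[RHS]/(val (exist (fun y => y \in B) _
    (subsetP (bij_image_sub s S) _ (valP y)))).
  by congr val; rewrite -[RHS]ts; congr (s _); apply: val_inj.
exists (Bij (Bijective fK gK)) => x y xy /=.
by congr (val (s _)); apply: val_inj.
Qed.

Lemma bij_set0 (U V : finType) (A : {set U}) (B : {set V}) (s : bij A B) :
  (A == set0) = (B == set0).
Proof.
have [t _] := bij_inverse s.
apply/idP/idP => /eqP E; apply/set0Pn => -[x xX].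
  by move: (valP (t (exist _ x xX))); move: (val _) => z; rewrite E inE.
by move: (valP (s (exist _ x xX))); move: (val _) => z; rewrite E inE.
Qed.

Lemma bij_decomp (U V : finType) (A : {set U}) (B : {set V}) (s : bij A B)
    (S T : {set U}) :
  is_decomp A S T -> is_decomp B (bij_image s S) (bij_image s T).
Proof.
have [t [st ts]] := bij_inverse s.
move=> H; rewrite decompE bij_image_sub; apply/eqP/setP => y.
rewrite inE; apply/idP/andP => [yT|[yS yB]].
  have yB := subsetP (bij_image_sub s T) _ yT; split=> //.
  pose z : {y : V | y \in B} := exist _ y yB; move: yT.
  rewrite -[y]/(val z) -(ts z) !mem_bij_image; apply: contraL => xS.
  by case/andP: H => _ /disjointFr ->.
pose z : {y : V | y \in B} := exist _ y yB; move: yS.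
rewrite -[y]/(val z) -(ts z) !mem_bij_image => xS; move: (valP (t z)) xS.
by move: (val _) => v; case/andP: H => /eqP <- _; rewrite inE => /orP[->|].
Qed.

End BijectionImages.

(** * Naturality of convolution products and of the convolution unit *)

Section Naturality.
Variables (k : fieldType) (h : bimonoid k).

(** Taking images under [s] is a bijection between the decompositions of A and those of B, and
    corresponding summands agree by naturality of all the maps involved. *)
Lemma conv_natural (f g : endo h) :
  endo_natural f -> endo_natural g -> endo_natural (conv f g).
Proof.
move=> fN gN U V A B s x; have [t [st ts]] := bij_inverse s.
pose F (d : decomp A) : decomp B :=
  exist _ (bij_image s (val d).1, bij_image s (val d).2)
    (bij_decomp s (valP d)).
pose G (d : decomp B) : decomp A :=
  exist _ (bij_image t (val d).1, bij_image t (val d).2)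
    (bij_decomp t (valP d)).
have FK : cancel F G.
  move=> d; apply: val_inj.
  rewrite /= !(bij_imageK st ts) -?surjective_pairing //.
    exact: decomp_subr (valP d).
  exact: decomp_subl (valP d).
have GK : cancel G F.
  move=> d; apply: val_inj.
  rewrite /= !(bij_imageK ts st) -?surjective_pairing //.
    exact: decomp_subr (valP d).
  exact: decomp_subl (valP d).
rewrite !convE linear_sum (reindex F); last by apply: onW_bij; exists G.
apply: eq_bigr => d _; rewrite !conv_atE.
have [s1 s1P] := bij_restrict s (decomp_subl (valP d)).
have [s2 s2P] := bij_restrict s (decomp_subr (valP d)).
rewrite (mu_natural _ _ (valP (F d)) s1P s2P).
rewrite (Delta_natural _ (valP d) (valP (F d)) s1P s2P).
rewrite !tmap_comp; congr (mon_mu _ _ _).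
by apply: eq_tmap => y /=; rewrite (fN, gN).
Qed.

Lemma endo_unit_natural : endo_natural (endo_unit h).
Proof.
move=> U V A B s x; have [A0|A0] := boolP (A == set0).
  have B0 : B == set0 by rewrite -(bij_set0 s).
  rewrite (endo_unitE A0) (endo_unitE B0).
  by rewrite (iota_natural _ _ B0) (eps_natural _ A0).
by rewrite !endo_unit0 ?linear0 // -(bij_set0 s).
Qed.

End Naturality.

(** * Existence of the antipode of a connected bimonoid *)

Section Antipode.
Variables (k : fieldType) (h : bimonoid k).
Hypothesis hconn : connected h.

(** Since [eps] sends [iota] of 1 to 1, that vector is nonzero and spans the one-dimensional space;
    on its multiples the claim is the same identity again. *)
Lemma connected_iota_epsK (U : finType) (E : {set U}) (e : E == set0)
    (x : h U E) :
  mon_iota (bim_monoid h) e (com_eps (bim_comonoid h) e x) = x.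
Proof.
have E0 := eqP e; subst E; have [b bP] := hconn U.
have span y : exists c : k, y = c *: b ord0.
  by have [c [-> _]] := bP y; exists (c ord0); rewrite big_ord1.
have [c cE] := span (mon_iota (bim_monoid h) e 1).
have [a ->] := span x.
have c0 : c != 0.
  apply/eqP => c0; have /eqP := bim_eps_iota h e 1.
  by rewrite cE c0 scale0r linear0 eq_sym oner_eq0.
have -> : b ord0 = c^-1 *: mon_iota (bim_monoid h) e 1.
  by rewrite cE scalerA mulVf // scale1r.
rewrite scalerA !(linearZ_LR (com_eps _ _), linearZ_LR (mon_iota _ _)).
by rewrite bim_eps_iota.
Qed.

(** For connected [h] this is id - u; the definition by cases makes it vanish at the empty set by
    construction. *)
Definition endo_aug : endo h := fun U I =>
  if (I == set0) as _ return {linear h U I -> h U I} then \0 else idfun.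

Lemma endo_aug_natural : endo_natural endo_aug.
Proof.
move=> U V A B s x; rewrite /endo_aug (bij_set0 s).
by case: ifP => _ //=; rewrite linear0.
Qed.

(** The equation id = u + (id - u), written as a combination indexed by [bool] to fit [conv_suml]
    and [conv_sumr]. *)
Lemma endo_id_sum (U : finType) (I : {set U}) (x : h U I) :
  endo_id h I x =
  \sum_(b : bool) 1 *: (if b then endo_unit h else endo_aug) U I x.
Proof.
rewrite big_bool /= !scale1r /endo_aug.
have [I0|I0] := boolP (I == set0).
  by rewrite (endo_unitE I0) connected_iota_epsK addr0.
by rewrite endo_unit0 // add0r.
Qed.

Fixpoint aug_pow (n : nat) : endo h :=
  if n is n'.+1 then conv endo_aug (aug_pow n') else endo_unit h.

Lemma aug_pow_natural n : endo_natural (aug_pow n).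
Proof.
elim: n => [|n IHn]; first exact: endo_unit_natural.
exact: conv_natural endo_aug_natural IHn.
Qed.

Lemma aug_powSr n (U : finType) (I : {set U}) (x : h U I) :
  conv (aug_pow n) endo_aug I x = aug_pow n.+1 I x.
Proof.
elim: n U I x => [|n IHn] U I x; first by rewrite conv_unitl /= conv_unitr.
by rewrite /= convA; apply: eq_conv => // S _ y; apply: IHn.
Qed.

(** A nonzero term gives each of the n factors a nonempty set, which requires at least n
    elements. *)
Lemma aug_pow_eq0 n (U : finType) (I : {set U}) (x : h U I) :
  (#|I| < n)%N -> aug_pow n I x = 0.
Proof.
elim: n U I x => // n IHn U I x In.
rewrite /= convE big1 // => d _; rewrite conv_atE /endo_aug.
have [d0|d0] := boolP ((val d).1 == set0).
  by rewrite tmap0l ?linear0.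
rewrite tmap0r ?linear0 // => y; apply: IHn.
move: In; rewrite ltnS; apply: leq_trans.
by rewrite (card_decomp (valP d)) -[ltnLHS]add0n ltn_add2r card_gt0.
Qed.

Definition takeuchi_fun (U : finType) (I : {set U}) (x : h U I) : h U I :=
  \sum_(n < #|I|.+1) (-1) ^+ n *: aug_pow n I x.

Lemma takeuchi_fun_is_linear U I : linear (@takeuchi_fun U I).
Proof.
move=> a x y; rewrite /takeuchi_fun scaler_sumr -big_split /=.
by apply: eq_bigr => n _; rewrite linearP scalerDr !scalerA mulrC.
Qed.

HB.instance Definition _ U I :=
  GRing.isLinear.Build k (h U I) (h U I) _ (@takeuchi_fun U I)
    (@takeuchi_fun_is_linear U I).

Definition takeuchi : endo h := fun U I => @takeuchi_fun U I.

(** The added powers vanish on I, so components at different sets can be written with the same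
    number of terms. *)
Lemma takeuchiE m (U : finType) (I : {set U}) (x : h U I) : (#|I| <= m)%N ->
  takeuchi I x = \sum_(n < m.+1) (-1) ^+ n *: aug_pow n I x.
Proof.
move=> Im; rewrite /takeuchi /= /takeuchi_fun.
rewrite (big_ord_widen m.+1 (fun n => (-1) ^+ n *: aug_pow n I x)) //.
rewrite big_mkcond /=.
apply: eq_bigr => n _; case: ifP => // /negbT; rewrite -ltnNge => In.
by rewrite aug_pow_eq0 ?scaler0.
Qed.

Lemma takeuchi_natural : endo_natural takeuchi.
Proof.
move=> U V A B s x.
(* A common truncation for both sets, obtained without comparing their cardinals. *)
rewrite (@takeuchiE (maxn #|A| #|B|)) ?leq_maxl //.
rewrite (@takeuchiE (maxn #|A| #|B|)) ?leq_maxr //.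
rewrite linear_sum; apply: eq_bigr => n _.
by rewrite linearZ /= aug_pow_natural.
Qed.

Lemma alternating_telescope (V : lmodType k) (a : nat -> V) m :
  \sum_(n < m.+1) (-1) ^+ n *: (a n + a n.+1) = a 0%N + (-1) ^+ m *: a m.+1.
Proof.
elim: m => [|m IHm]; first by rewrite big_ord1 !scale1r.
rewrite big_ord_recr /= IHm scalerDr addrA exprS mulN1r !scaleNr.
by rewrite addrK.
Qed.

Lemma takeuchi_is_antipode : is_antipode takeuchi.
Proof.
(* Multiplying the n-th power by id = u + (id - u), on either side, gives the n-th plus the next
   power. The alternating sum telescopes to the power 0, which is u, because the last power vanishes
   on I. *)
have tel (U : finType) (I : {set U}) (x : h U I) :
    \sum_(n < #|I|.+1) (-1) ^+ n *: (aug_pow n I x + aug_pow n.+1 I x) =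
    endo_unit h I x.
  rewrite (alternating_telescope (fun n => aug_pow n I x)).
  by rewrite (aug_pow_eq0 (n := _.+1)) // scaler0 addr0.
split=> [|U I x|U I x]; first exact: takeuchi_natural.
  rewrite (conv_suml (r := index_enum 'I_(#|I|.+1)) (c := fun n => (-1) ^+ n)
    (F := fun n => aug_pow n)) -?tel; last first.
    by move=> S SI y; apply: takeuchiE; apply: subset_leq_card.
  apply: eq_bigr => n _; congr (_ *: _).
  rewrite (conv_sumr (r := index_enum bool) (c := fun=> 1)
    (G := fun b : bool => if b then endo_unit h else endo_aug) _ _
    (fun S _ => @endo_id_sum U S)) big_bool /= !scale1r.
  by rewrite conv_unitr aug_powSr.
rewrite (conv_sumr (r := index_enum 'I_(#|I|.+1)) (c := fun n => (-1) ^+ n)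
  (G := fun n => aug_pow n) _ _) -?tel; last first.
  by move=> S SI y; apply: takeuchiE; apply: subset_leq_card.
apply: eq_bigr => n _; congr (_ *: _).
rewrite (conv_suml (r := index_enum bool) (c := fun=> 1)
    (F := fun b : bool => if b then endo_unit h else endo_aug) _ _
    (fun S _ => @endo_id_sum U S)) big_bool /= !scale1r.
by rewrite conv_unitl.
Qed.

(** [antipode] selects some inverse as soon as one exists, and [takeuchi] is a witness. *)
Lemma antipodeP : is_antipode (antipode h).
Proof.
rewrite /antipode; case: pselect => [exS|[]]; first by case: (cid exS).
by exists takeuchi; apply: takeuchi_is_antipode.
Qed.

End Antipode.

(** * Compositions as lists of blocks *)

Section CompositionLists.
Variable U : finType.
Implicit Types (I A : {set U}) (F : seq {set U}).

(** Plain lists, whose type does not depend on I, so that a first block can be removed or added. *)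
Definition comps I : seq (seq {set U}) :=
  [seq \val (\val F) | F : composition I].

Lemma mem_comps I F : (F \in comps I) = is_comp I F.
Proof.
apply/mapP/idP => [[G _ ->]|c]; first exact: valP G.
exists (exist _ (Bseq (is_comp_size c)) c : composition I) => //.
by rewrite mem_enum.
Qed.

Lemma comps_uniq I : uniq (comps I).
Proof. by rewrite map_inj_uniq ?enum_uniq // => F G /val_inj /val_inj. Qed.

Lemma is_comp_consE I A F :
  is_comp I (A :: F) = [&& A != set0, A \subset I & is_comp (I :\: A) F].
Proof.
apply/idP/and3P => [c|[A0 AI /and3P[F0 dF /eqP FE]]].
  have [H cF] := is_comp_cons c; split=> //; last exact: decomp_subl H.
  by case/and3P: c; rewrite inE negb_or eq_sym => /andP[].
rewrite /is_comp /= inE negb_or eq_sym A0 F0 dF big_cons FE andbT.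
have /andP[/eqP-> _] := decompDl AI; rewrite eqxx !andbT /=.
(* Each block of the tail lies in the complement of A, hence is disjoint from A. *)
apply/allP => B BF; rewrite -setI_eq0 -subset0.
have BIA : B \subset I :\: A by rewrite -FE (big_rem B) //= subsetUl.
apply: subset_trans (setIS A BIA) _.
by rewrite setIDA [A :&: I]setIC -setIDA setDv setI0.
Qed.

Lemma is_comp_set0 F : is_comp (set0 : {set U}) F = (F == [::]).
Proof.
case: F => [|A F]; first by rewrite /is_comp big_nil eqxx.
by rewrite is_comp_consE subset0; case: (A == set0).
Qed.

(** The choice A = I is included: its tail is the empty list, the only composition of the empty
    set. *)
Lemma comps_cons I : I != set0 ->
  perm_eq (comps I)
    [seq A :: F | A <- enum [pred A : {set U} | A != set0 & A \subset I],
                  F <- comps (I :\: A)].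
Proof.
move=> I0; apply: uniq_perm; first exact: comps_uniq.
  apply: allpairs_uniq_dep => [|A _|[A F] [B G] _ _ /= [-> ->] //].
    exact: enum_uniq.
  exact: comps_uniq.
case=> [|A F].
  rewrite mem_comps; apply/idP/allpairsPdep => [/is_comp_nil|[A [F []]] //].
  by rewrite (negPf I0).
rewrite mem_comps is_comp_consE; apply/and3P/allpairsPdep.
  by case=> A0 AI cF; exists A, F; rewrite mem_enum inE A0 AI mem_comps.
case=> B [G [+ + [-> ->]]]; rewrite mem_enum inE mem_comps.
by case/andP.
Qed.

End CompositionLists.

(** * The action of the Dynkin series and its convolution with the identity *)

Section Dynkin.
Variables (k : fieldType) (h : bimonoid k).

Section Fixed.
Variable U : finType.
Implicit Types (I A : {set U}) (F : seq {set U}).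

(** The operator [mu_seq] after [Delta_seq], extended by zero to lists that are not compositions of
    I, so that sums can run over lists. *)
Definition comp_op I F : {linear h U I -> h U I} :=
  match @idP (is_comp I F) with
  | ReflectT c => mu_seq h c \o Delta_seq h c
  | ReflectF _ => \0
  end.

Lemma comp_opE I F (c : is_comp I F) x :
  comp_op I F x = mu_seq h c (Delta_seq h c x).
Proof.
rewrite /comp_op; case: {-}_ / idP => // c'.
by rewrite (bool_irrelevance c' c).
Qed.

Lemma comp_op1 I x : I != set0 -> comp_op I [:: I] x = x.
Proof.
move=> I0; have c : is_comp I [:: I].
  by rewrite is_comp_consE I0 subxx setDv is_comp_set0.
(* Only the two casts along I = I remain; proof irrelevance makes them identities. *)
rewrite (comp_opE c) /=; move: (is_comp_single c) => e.
by rewrite (Prop_irrelevance e (erefl I)).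
Qed.

(** The tail is nonempty because the iterated maps treat a single block as a cast rather than as a
    product with the unit. *)
Lemma comp_op_cons I A F (H : is_decomp I A (I :\: A)) x :
    A != set0 -> F != [::] -> is_comp (I :\: A) F ->
  comp_op I (A :: F) x = conv_at idfun (comp_op (I :\: A) F) H x.
Proof.
case: F => // B F A0 _ cF.
have c : is_comp I [:: A, B & F] by rewrite is_comp_consE A0 (decomp_subl H).
rewrite (comp_opE c) conv_atE.
rewrite (bool_irrelevance H (is_comp_cons c).1).
have -> z : tmap idfun (comp_op (I :\: A) (B :: F)) z =
    tmap idfun (mu_seq h (is_comp_cons c).2)
      (tmap idfun (Delta_seq h (is_comp_cons c).2) z).
  rewrite tmap_comp; apply: eq_tmap => // y.
  exact: comp_opE.
by [].
Qed.

Definition dynkin_coef F : k := (-1) ^+ (size F).-1 * #|last_block F|%:R.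

(** The last block stays the same while the length grows by one. This sign is the source of the
    cancellation. *)
Lemma dynkin_coef_cons A F : F != [::] ->
  dynkin_coef (A :: F) = - dynkin_coef F.
Proof.
by case: F => // B F _; rewrite /dynkin_coef /= exprS mulN1r mulNr.
Qed.

Lemma Psi_dynkin0 I x : I == set0 -> Psi h (@dynkin k) I x = 0.
Proof.
move=> I0; rewrite /Psi /= /Psi_fun big1 // => F _.
by rewrite /dynkin I0 ffunE scale0r.
Qed.

Lemma Psi_dynkinE I x : I != set0 ->
  Psi h (@dynkin k) I x = \sum_(F <- comps I) dynkin_coef F *: comp_op I F x.
Proof.
move=> I0; rewrite /Psi /= /Psi_fun big_image; apply: eq_bigr => F _ /=.
rewrite (comp_opE (valP F)); congr (_ *: _).
rewrite /dynkin (negPf I0) sum_ffunE (bigD1 F) //= big1 ?addr0 => [|G neq].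
  by rewrite !ffunE eqxx; apply: mulr1.
by rewrite !ffunE eq_sym (negPf neq); apply: mulr0.
Qed.

Lemma conv_at_Psi_dynkin I A (H : is_decomp I A (I :\: A)) x :
    A != set0 -> I :\: A != set0 ->
  conv_at idfun (Psi h (@dynkin k) (I :\: A)) H x =
  - \sum_(F <- comps (I :\: A)) dynkin_coef (A :: F) *: comp_op I (A :: F) x.
Proof.
move=> A0 IA0; rewrite conv_atE.
rewrite (tmap_sumr _ _ (fun y => Psi_dynkinE y IA0)) linear_sum -sumrN.
rewrite big_seq [RHS]big_seq; apply: eq_bigr => F; rewrite mem_comps => cF.
have F0 : F != [::].
  by apply: contraNneq IA0 => F0; apply: is_comp_nil; rewrite -F0.
rewrite dynkin_coef_cons // scaleNr opprK linearZ /=; congr (_ *: _).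
by rewrite (comp_op_cons H).
Qed.

Lemma conv_subsetE (f g : endo h) I x :
  conv f g I x =
  \sum_A when (fun H : is_decomp I A (I :\: A) =>
    conv_at (f U A) (g U (I :\: A)) H x).
Proof.
rewrite convE (big_decomp (fun S T H => conv_at (f U S) (g U T) H x)).
apply: eq_bigr => A _; rewrite (bigD1 (I :\: A)) //= big1 ?addr0 // => T neq.
by rewrite whenF // decompE negb_and neq orbT.
Qed.

(** For connected [h] the left side is the convolution of id = u + (id - u) with the Dynkin
    operator. Both summands are sorted by a set A: the first block on one side, the first set of the
    decomposition on the other. *)
Lemma Psi_dynkin_aug I x : I != set0 ->
  Psi h (@dynkin k) I x + conv (endo_aug h) (Psi h (@dynkin k)) I x =
  #|I|%:R *: x.
Proof.
move=> I0; rewrite Psi_dynkinE // (perm_big _ (comps_cons I0)) /=.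
rewrite big_allpairs_dep big_enum conv_subsetE.
pose P A := \sum_(F <- comps (I :\: A))
  dynkin_coef (A :: F) *: comp_op I (A :: F) x.
pose Q A := when (fun H : is_decomp I A (I :\: A) =>
  conv_at (endo_aug h A) (Psi h (@dynkin k) (I :\: A)) H x).
transitivity (\sum_(A | (A != set0) && (A \subset I)) P A + \sum_A Q A) => //.
rewrite [X in X + _]big_mkcond -big_split /= (bigD1 I) //= I0 subxx /=.
rewrite big1 ?addr0 => [|A AI].
  (* At A = I the convolution term contains the Dynkin component at the empty set, which is zero;
     the composition with single block I has coefficient |I|. *)
  rewrite /Q (whenT _ (decompDl (subxx I))) conv_atE tmap0r; last first.
    by move=> y; rewrite Psi_dynkin0 // setDv.
  rewrite linear0 addr0 /P (perm_big [:: [::]]) ?big_seq1.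
    by rewrite comp_op1 // /dynkin_coef /= expr0 mul1r.
  apply: uniq_perm => [||F]; rewrite ?comps_uniq //.
  by rewrite mem_comps setDv is_comp_set0 inE.
have [-> | A0] := eqVneq A set0.
  rewrite add0r /Q (whenT _ (decompDl (sub0set I))) conv_atE tmap0l ?linear0 //.
  by move=> y; rewrite /endo_aug eqxx.
have /orP[sAI|nAI] := orbN (A \subset I); last first.
  by rewrite (negPf nAI) /Q whenF ?addr0 // decompE negb_and nAI.
have H := decompDl sAI; rewrite sAI /Q (whenT _ H).
have IA0 : I :\: A != set0.
  by apply: contraNneq AI => /eqP; rewrite setD_eq0 eqEsubset sAI.
(* For A nonempty and proper, id - u acts as the identity on A, and the convolution term is the
   negative of the sum over compositions with first block A. *)
have -> : conv_at (endo_aug h A) (Psi h (@dynkin k) (I :\: A)) H x =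
    conv_at idfun (Psi h (@dynkin k) (I :\: A)) H x.
  rewrite !conv_atE; congr (mon_mu _ _ _); apply: eq_tmap => // y.
  by rewrite /endo_aug (negPf A0).
by rewrite conv_at_Psi_dynkin // subrr.
Qed.

End Fixed.

Lemma conv_id_Psi_dynkin (hconn : connected h) (U : finType) (I : {set U})
    (x : h U I) :
  conv (endo_id h) (Psi h (@dynkin k)) I x = number_op h I x.
Proof.
rewrite (conv_suml (r := index_enum bool) (c := fun=> 1)
  (F := fun b : bool => if b then endo_unit h else endo_aug h) _ _
  (fun S _ => @endo_id_sum _ _ hconn U S)) big_bool /= !scale1r conv_unitl.
have [I0|I0] := boolP (I == set0); last exact: Psi_dynkin_aug.
(* At the empty set the number operator is zero, and every Dynkin factor sits on an empty set. *)
rewrite Psi_dynkin0 // add0r /number_op_fun.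
have -> : #|I| = 0%N by rewrite (eqP I0) cards0.
rewrite scale0r.
rewrite convE big1 // => d _; rewrite conv_atE tmap0r ?linear0 // => y.
apply: Psi_dynkin0; rewrite -subset0 -(eqP I0).
exact: decomp_subr (valP d).
Qed.

End Dynkin.

Theorem corollary110 (k : fieldType) (h : bimonoid k) (hconn : connected h)
    (U : finType) (I : {set U}) (x : h U I) :
  Psi h (@dynkin k) I x = conv (antipode h) (number_op h) I x.
Proof.
have [_ antL _] := antipodeP hconn.
(* Insert u on the left, replace it by the antipode convolved with id, and reassociate. *)
rewrite -[LHS]conv_unitl.
transitivity (conv (antipode h) (conv (endo_id h) (Psi h (@dynkin k))) I x).
  by rewrite -convA; apply: eq_conv => // S _ y; rewrite antL.
by apply: eq_conv => // S _ y; apply: conv_id_Psi_dynkin.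
Qed.
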